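(* Let $C=(c_{n,k}(q))_{n,k\ge0}$ be defined by $c_{0,0}(q)=1$, $c_{n,k}(q)=0$ unless $n\ge k\ge 0$, and, for $n\ge1$, one of the following two recurrences: (1) for some real numbers $f\ge e\ge 0$, $c_{n,0}(q)=[(f-e)+eq]\,c_{n-1,0}(q)+fq\,c_{n-1,1}(q)$ and $c_{n,k}(q)=c_{n-1,k-1}(q)+(1+q)\,c_{n-1,k}(q)+q\,c_{n-1,k+1}(q)$ for $k\ge1$; (2) for some real numbers $e,f\ge1$, $c_{n,0}(q)=[(f-1)+eq]\,c_{n-1,0}(q)+efq\,c_{n-1,1}(q)$ and $c_{n,k}(q)=c_{n-1,k-1}(q)+(1+eq)\,c_{n-1,k}(q)+eq\,c_{n-1,k+1}(q)$ for $k\ge1$. Then the Hankel matrix $(c_{i+j,0}(q))_{i,j\ge0}$ is $q$-totally positive.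
   Context: A matrix whose entries are polynomials in $q$ is called $q$-totally positive if every minor (determinant of a finite square submatrix) has all coefficients nonnegative. *)

(* Defs.v *)
From HB Require Import structures.
From mathcomp Require Import all_boot all_order all_algebra.
From mathcomp Require Import reals.
Set Implicit Arguments.
Unset Strict Implicit.
Unset Printing Implicit Defensive.

Import Order.TTheory GRing.Theory Num.Theory.
Local Open Scope ring_scope.

Definition strictly_increasing (m : nat) (r : 'I_m -> nat) : Prop :=
  forall i j : 'I_m, (i < j)%N -> (r i < r j)%N.

(* Polynomials in q are elements of {poly R}, with q := 'X.  Infinite matrices
   are functions nat -> nat -> {poly R}; the m x m submatrix on rows r and
   columns c is given by the increasing enumerations of its index sets. *)
Definition q_totally_positive (R : realType) (M : nat -> nat -> {poly R})
    : Prop :=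
  forall (m : nat) (r c : 'I_m -> nat),
    strictly_increasing r -> strictly_increasing c ->
    forall d : nat, 0 <= (\det (\matrix_(i < m, j < m) M (r i) (c j)))`_d.

Definition recurrence1 (R : realType) (e f : R) (c : nat -> nat -> {poly R})
    : Prop :=
  (forall n, c n.+1 0%N =
     ((f - e)%:P + e *: 'X) * c n 0%N + (f *: 'X) * c n 1%N) /\
  (forall n k, c n.+1 k.+1 =
     c n k + (1 + 'X) * c n k.+1 + 'X * c n k.+2).

Definition recurrence2 (R : realType) (e f : R) (c : nat -> nat -> {poly R})
    : Prop :=
  (forall n, c n.+1 0%N =
     ((f - 1)%:P + e *: 'X) * c n 0%N + ((e * f) *: 'X) * c n 1%N) /\
  (forall n k, c n.+1 k.+1 =
     c n k + (1 + e *: 'X) * c n k.+1 + (e *: 'X) * c n k.+2).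

(* Main.v *)
(** Both recurrences say that row [n + 1] of [C] is row [n] times a tridiagonal
    matrix [J] with superdiagonal entries [1], diagonal entries
    [a + e x, 1 + x, 1 + x, ...] and subdiagonal entries [(a + e) x, x, x, ...],
    where [(a, e, x)] is [(f - e, e, q)] or [(f - 1, 1, e q)].

    By Cauchy-Binet, products preserve total positivity.  It is obvious for
    bidiagonal matrices, and the first column of [J] is a combination with
    coefficients [a] and [e] of those for [(a, e) = (1, 0)] and
    [(a, e) = (0, 1)], where [J] is the product of an upper and a lower
    bidiagonal matrix with nonnegative entries.  So [J] is totally positive,
    hence so is [C], by induction on the number of rows, and so is the Hankel
    matrix, which factors as [C W C^T] with [W] the diagonal matrix of the
    products of the first subdiagonal entries of [J]. *)
Require Import Defs.
From HB Require Import structures.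
From mathcomp Require Import all_boot all_order all_algebra.
From mathcomp Require Import fingroup perm ring zify.
From mathcomp Require Import reals.
Set Implicit Arguments.
Unset Strict Implicit.
Unset Printing Implicit Defensive.

Import Order.TTheory GRing.Theory Num.Theory.
Local Open Scope ring_scope.

Lemma sum_uniq_tuple_sorted (V : nmodType) d (T : finOrderType d) m
    (F : m.-tuple T -> V) :
  \sum_(t : m.-tuple T | uniq t) F t =
  \sum_(t : m.-tuple T | sorted <%O t)
    \sum_(s : 'S_m) F [tuple tnth t (s i) | i < m].
Proof.
pose arrange (ts : m.-tuple T * 'S_m) := [tuple tnth ts.1 (ts.2 i) | i < m].
pose sorted_pairs := [set ts : m.-tuple T * 'S_m | sorted <%O ts.1].
have perm_arrange ts : perm_eq (arrange ts) ts.1.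
  by apply/tuple_permP; exists ts.2.
have arrange_inj : {in sorted_pairs &, injective arrange}.
  move=> [t s] [t' s']; rewrite !inE => /= t_sorted t'_sorted eq_arr.
  have eq_t : t = t'.
    apply/val_inj/lt_sorted_eq => // y.
    rewrite -(perm_mem (perm_arrange (t, s))) eq_arr.
    exact: perm_mem (perm_arrange _) y.
  congr pair => //; apply/permP => i.
  have := congr1 (fun u => tnth u i) eq_arr; rewrite !tnth_mktuple /= -eq_t.
  exact/tuple_uniqP/lt_sorted_uniq.
transitivity (\sum_(u in arrange @: sorted_pairs) F u); last first.
  rewrite big_imset // pair_big_dep; apply: eq_bigl => ts.
  by rewrite inE andbT.
apply: eq_bigl => u; apply/idP/imsetP => [u_uniq | [ts]].
  have /tuple_permP[s uE] : perm_eq u (sort <=%O u).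
    by rewrite perm_sym perm_sort.
  exists ([tuple of sort <=%O u], s); last exact: val_inj.
  by rewrite inE sort_lt_sorted.
by rewrite inE => /lt_sorted_uniq + ->; rewrite (perm_uniq (perm_arrange ts)).
Qed.

Section CauchyBinet.
Variable K : comPzRingType.

Lemma det_rowsub_perm m n (B : 'M[K]_(n, m)) (f : 'I_m -> 'I_n) (s : 'S_m) :
  \det (rowsub (f \o s) B) = (-1) ^+ s * \det (rowsub f B).
Proof. by rewrite rowsub_comp -row_permEsub row_permE det_mulmx det_perm. Qed.

Lemma det_mulmx_tuple m n (A : 'M[K]_(m, n)) (B : 'M[K]_(n, m)) :
  \det (A *m B) =
  \sum_(t : m.-tuple 'I_n) (\prod_i A i (tnth t i)) * \det (rowsub (tnth t) B).
Proof.
transitivity (\sum_(t : m.-tuple 'I_n) \sum_(s : 'S_m)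
    (-1) ^+ s * \prod_i (A i (tnth t i) * B (tnth t i) (s i))); last first.
  apply: eq_bigr => t _; rewrite big_distrr; apply: eq_bigr => s _ /=.
  rewrite big_split mulrCA; congr (_ * (_ * _)).
  by apply: eq_bigr => i _; rewrite !mxE.
rewrite exchange_big; apply: eq_bigr => s _.
rewrite -big_distrr /=; congr (_ * _).
under eq_bigr do rewrite mxE.
rewrite bigA_distr_bigA (reindex (@finfun_of_tuple _ _)) /=; last first.
  exists (@tuple_of_finfun _ _) => f _; first exact: finfun_of_tupleK.
  exact: tuple_of_finfunK.
by apply: eq_bigr => t _; apply: eq_bigr => i _; rewrite ffunE.
Qed.

Theorem cauchy_binet m n (A : 'M[K]_(m, n)) (B : 'M[K]_(n, m)) :
  \det (A *m B) =
  \sum_(t : m.-tuple 'I_n | sorted <%O t)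
    \det (colsub (tnth t) A) * \det (rowsub (tnth t) B).
Proof.
rewrite det_mulmx_tuple (bigID (fun t : m.-tuple 'I_n => uniq t)) /=.
rewrite [X in _ + X]big1 ?addr0 => [|t]; last first.
  move=> /tuple_uniqP/injectiveP/injectivePn[i [j ij tij]].
  by rewrite (determinant_alternate ij) ?mulr0 // => k; rewrite !mxE tij.
rewrite sum_uniq_tuple_sorted; apply: eq_bigr => t _.
rewrite [\det (colsub _ A)]/determinant big_distrl; apply: eq_bigr => s _ /=.
rewrite -det_tr.
have -> : rowsub (tnth [tuple tnth t (s i) | i < m]) B = rowsub (tnth t \o s) B.
  by apply/matrixP => i j; rewrite !mxE tnth_mktuple.
rewrite det_tr det_rowsub_perm mulrCA mulrA; congr (_ * _ * _).
by apply: eq_bigr => i _; rewrite mxE tnth_mktuple.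
Qed.

End CauchyBinet.

Section IncreasingSequences.
Variables (m : nat) (r : 'I_m.+1 -> nat).
Hypothesis r_incr : strictly_increasing r.

Lemma strictly_increasing_behead : strictly_increasing (r \o lift ord0).
Proof. by move=> i j ij; apply: r_incr; rewrite !lift0. Qed.

Lemma strictly_increasing_head_lt i : (r ord0 < r (lift ord0 i))%N.
Proof. exact: r_incr. Qed.

Lemma strictly_increasing_head_le i : (r ord0 <= r i)%N.
Proof.
by have [k ->|->//] := unliftP ord0 i; apply/ltnW/strictly_increasing_head_lt.
Qed.

End IncreasingSequences.

Lemma strictly_increasing_tnth m n (t : m.-tuple 'I_n) :
  sorted <%O t -> strictly_increasing (val \o tnth t).
Proof.
move=> t_sorted i j ij; have := lt_sorted_ltn_nth (tnth t i) t_sorted.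
by move/(_ i j); rewrite !inE !size_tuple !ltn_ord -!tnth_nth ltEord => ->.
Qed.

Section Minors.
Variable K : comPzRingType.
Implicit Types (M A B : nat -> nat -> K).

Definition minor M (m : nat) (r c : 'I_m -> nat) : K :=
  \det (\matrix_(i < m, j < m) M (r i) (c j)).

Lemma eq_minor M M' m (r c : 'I_m -> nat) :
  (forall i j, M (r i) (c j) = M' (r i) (c j)) -> minor M r c = minor M' r c.
Proof. by move=> eqM; congr (\det _); apply/matrixP => i j; rewrite !mxE. Qed.

Lemma minor_size0 M (r c : 'I_0 -> nat) : minor M r c = 1.
Proof. exact: det_mx00. Qed.

Lemma minor_tr M m (r c : 'I_m -> nat) :
  minor (fun i j => M j i) r c = minor M c r.
Proof.
by rewrite /minor -det_tr; congr (\det _); apply/matrixP=> i j; rewrite !mxE.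
Qed.

Lemma minor_row0 M m (r c : 'I_m.+1 -> nat) :
  (forall j, M (r ord0) (c (lift ord0 j)) = 0) ->
  minor M r c = M (r ord0) (c ord0) * minor M (r \o lift ord0) (c \o lift ord0).
Proof.
move=> M0; rewrite /minor (expand_det_row _ ord0) big_ord_recl.
rewrite big1 ?addr0 => [|j _]; last by rewrite mxE M0 mul0r.
rewrite mxE /cofactor expr0 mul1r; congr (_ * \det _).
by apply/matrixP => i j; rewrite !mxE.
Qed.

Lemma minor_col0 M m (r c : 'I_m.+1 -> nat) :
  (forall i, M (r (lift ord0 i)) (c ord0) = 0) ->
  minor M r c = M (r ord0) (c ord0) * minor M (r \o lift ord0) (c \o lift ord0).
Proof. by move=> M0; rewrite -!(minor_tr M) minor_row0. Qed.

Lemma minor_scale_rows w M m (r c : 'I_m -> nat) :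
  minor (fun i j => w i * M i j) r c = (\prod_i w (r i)) * minor M r c.
Proof.
have -> : \prod_i w (r i) = \det (diag_mx (\row_i w (r i))).
  by rewrite det_diag; apply: eq_bigr => i _; rewrite mxE.
rewrite /minor -det_mulmx mul_diag_mx.
by congr (\det _); apply/matrixP => i j; rewrite !mxE.
Qed.

Lemma minor_row0_lincomb a b A B M m (r c : 'I_m.+1 -> nat) :
  (forall j, M (r ord0) j = a * A (r ord0) j + b * B (r ord0) j) ->
  (forall i j, A (r (lift ord0 i)) j = M (r (lift ord0 i)) j) ->
  (forall i j, B (r (lift ord0 i)) j = M (r (lift ord0 i)) j) ->
  minor M r c = a * minor A r c + b * minor B r c.
Proof.
move=> M0 AM BM; apply: (@determinant_multilinear _ _ _ _ _ ord0).
- by apply/rowP => j; rewrite !mxE.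
- by apply/matrixP => i j; rewrite !mxE.
- by apply/matrixP => i j; rewrite !mxE.
Qed.

Lemma minor_mul A B N m (r c : 'I_m -> nat) :
  minor (fun i j => \sum_(k < N) A i k * B k j) r c =
  \sum_(t : m.-tuple 'I_N | sorted <%O t)
    minor A r (val \o tnth t) * minor B (val \o tnth t) c.
Proof.
transitivity (\det ((\matrix_(i < m, k < N) A (r i) k) *m
                    (\matrix_(k < N, j < m) B k (c j)))).
  congr (\det _); apply/matrixP => i j; rewrite !mxE.
  by apply: eq_bigr => k _; rewrite !mxE.
rewrite cauchy_binet; apply: eq_bigr => t _.
by congr (_ * _); congr (\det _); apply/matrixP => i j; rewrite !mxE.
Qed.

End Minors.

Lemma sum_ord_widen (V : nmodType) (F : nat -> V) n N :
  (n <= N)%N -> (forall k, (n <= k)%N -> F k = 0) ->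
  \sum_(k < n) F k = \sum_(k < N) F k.
Proof.
move=> nN F0; rewrite (big_ord_widen N) // big_mkcond.
by apply: eq_bigr => k _; case: ltnP => // /F0.
Qed.

Section TotalPositivity.
Variables (K : comPzRingType) (S : semiringClosed K).
Implicit Types (M A B : nat -> nat -> K).

Definition totally_positive M : Prop :=
  forall m (r c : 'I_m -> nat),
    strictly_increasing r -> strictly_increasing c -> minor M r c \in S.

Lemma totally_positive_tr M :
  totally_positive (fun i j => M j i) -> totally_positive M.
Proof. by move=> M_tp m r c ri ci; rewrite -minor_tr; apply: M_tp. Qed.

Lemma totally_positive_scale_rows w M :
  (forall i, w i \in S) -> totally_positive M ->
  totally_positive (fun i j => w i * M i j).
Proof.
move=> wS M_tp m r c ri ci.
by rewrite minor_scale_rows rpredM ?rpred_prod ?M_tp.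
Qed.

Lemma totally_positive_mul (b : nat -> nat) A B M :
  (forall i k, (b i <= k)%N -> A i k = 0) ->
  (forall i j, M i j = \sum_(k < b i) A i k * B k j) ->
  totally_positive A -> totally_positive B -> totally_positive M.
Proof.
move=> A0 M_AB A_tp B_tp m r c ri ci; pose N := \max_i b (r i).
rewrite (@eq_minor _ _ (fun i j => \sum_(k < N) A i k * B k j)) => [|i j].
  rewrite minor_mul; apply: rpred_sum => t /strictly_increasing_tnth ti.
  by rewrite rpredM ?A_tp ?B_tp.
rewrite M_AB.
apply: (@sum_ord_widen _ (fun k => A (r i) k * B k (c j))) => [|k /A0->].
  exact: (leq_bigmax i).
by rewrite mul0r.
Qed.

Lemma totally_positive_row0_lincomb a b A B M :
  a \in S -> b \in S -> totally_positive A -> totally_positive B ->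
  (forall j, M 0%N j = a * A 0%N j + b * B 0%N j) ->
  (forall i j, A i.+1 j = M i.+1 j) -> (forall i j, B i.+1 j = M i.+1 j) ->
  totally_positive M.
Proof.
move=> aS bS A_tp B_tp M0 AM BM [|m] r c ri ci.
  by rewrite minor_size0 rpred1.
have r_gt0 i : (0 < r (lift ord0 i))%N.
  exact: leq_ltn_trans (strictly_increasing_head_lt ri i).
have [r0 | r0] := posnP (r ord0).
  rewrite (@minor_row0_lincomb _ a b A B) => [|j|i j|i j].
  - by rewrite rpredD ?rpredM ?A_tp ?B_tp.
  - by rewrite r0 M0.
  - by rewrite -(prednK (r_gt0 i)) AM.
  - by rewrite -(prednK (r_gt0 i)) BM.
rewrite -(@eq_minor _ A) ?A_tp // => i j.
by rewrite -(prednK (leq_trans r0 (strictly_increasing_head_le ri i))) AM.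
Qed.

Lemma totally_positive_of_behead_rows M :
  M 0%N 0%N \in S -> (forall j, M 0%N j.+1 = 0) ->
  totally_positive (fun i j => M i.+1 j) -> totally_positive M.
Proof.
move=> M00 M0 M_tp.
have minor_pos_rows m (r c : 'I_m -> nat) : strictly_increasing r ->
    strictly_increasing c -> (forall i, 0 < r i)%N -> minor M r c \in S.
  move=> ri ci r_gt0.
  have -> : minor M r c = minor (fun i j => M i.+1 j) (predn \o r) c.
    by congr (\det _); apply/matrixP => i j; rewrite !mxE /= prednK.
  by apply: M_tp => // i j /ri /=; rewrite -{1}(prednK (r_gt0 i)); case: (r j).
move=> [|m] r c ri ci; first by rewrite minor_size0 rpred1.
have [r0 | r0] := posnP (r ord0); last first.
  apply: minor_pos_rows => // i.
  exact: leq_trans r0 (strictly_increasing_head_le ri i).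
rewrite minor_row0 => [|j]; last first.
  by rewrite r0; case: (c (lift _ _)) (strictly_increasing_head_lt ci j).
apply: rpredM; first by rewrite r0; case: (c ord0) => // j; rewrite M0 rpred0.
apply: minor_pos_rows; try exact: strictly_increasing_behead.
by move=> i; apply: leq_ltn_trans (strictly_increasing_head_lt ri i).
Qed.

(* Every minor of a bidiagonal matrix is zero or a product of entries: the
   first row or the first column of the submatrix has a single entry in the
   band. *)
Lemma totally_positive_upper_band M :
  (forall i j, M i j \in S) ->
  (forall i j, (j < i)%N || (i.+1 < j)%N -> M i j = 0) ->
  totally_positive M.
Proof.
move=> MS M0; elim=> [|m IHm] r c ri ci; first by rewrite minor_size0 rpred1.
have IH : minor M (r \o lift ord0) (c \o lift ord0) \in S.
  by apply: IHm; apply: strictly_increasing_behead.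
have [cr | rc] := leqP (c ord0) (r ord0).
  rewrite minor_col0 ?rpredM // => i.
  by rewrite M0 // (leq_ltn_trans cr) ?strictly_increasing_head_lt.
rewrite minor_row0 ?rpredM // => j.
by rewrite M0 // (leq_ltn_trans rc) ?orbT ?strictly_increasing_head_lt.
Qed.

End TotalPositivity.

Section Jacobi.
Variables (K : comPzRingType) (S : semiringClosed K).
Implicit Types s t d l : nat -> K.

Definition jacobi s t (i j : nat) : K :=
  (j == i.+1)%:R + s j *+ (i == j) + t j *+ (i == j.+1).

Definition upper_bidiagonal d u (i j : nat) : K :=
  d i *+ (j == i) + u i *+ (j == i.+1).

Lemma totally_positive_upper_bidiagonal d u :
  (forall i, d i \in S) -> (forall i, u i \in S) ->
  totally_positive S (upper_bidiagonal d u).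
Proof.
move=> dS uS; apply: totally_positive_upper_band => i j.
  by rewrite rpredD ?rpredMn.
rewrite /upper_bidiagonal => off.
have /negPf-> : j != i by lia.
have /negPf-> : j != i.+1 by lia.
by rewrite !mulr0n addr0.
Qed.

Lemma jacobi_factor d l i j :
  jacobi (fun k => d k + l k) (fun k => d k.+1 * l k) i j =
  \sum_(k < i.+2)
    upper_bidiagonal d (fun=> 1) i k * upper_bidiagonal (fun=> 1) l j k.
Proof.
rewrite !big_ord_recr big1 /= ?add0r => [|k _]; last first.
  rewrite /upper_bidiagonal (ltn_eqF (ltn_ord k)) ltn_eqF ?mul0r //.
    by rewrite mulr0n addr0 mul0r.
  exact/ltnW/ltn_ord.
rewrite /upper_bidiagonal /jacobi !eqxx (ltn_eqF (ltnSn i)) (gtn_eqF (ltnSn i)).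
rewrite eqSS (eq_sym j) !mulr0n !mulr1n addr0 add0r mul1r mulrDr mulrnAr mulr1.
have [<-|_] := eqVneq i j.
  by rewrite (gtn_eqF (ltnSn i)) (ltn_eqF (ltnSn i)) !(mulr0n, mulr1n); ring.
by have [->|_] := eqVneq i j.+1; rewrite !(mulr0n, mulr1n); ring.
Qed.

Lemma totally_positive_jacobi d l :
  (forall k, d k \in S) -> (forall k, l k \in S) ->
  totally_positive S (jacobi (fun k => d k + l k) (fun k => d k.+1 * l k)).
Proof.
move=> dS lS.
apply: (totally_positive_mul (b := fun i => i.+2)
  (B := fun k j => upper_bidiagonal (fun=> 1) l j k) _ (jacobi_factor d l))
  => [i k ik||].
- by rewrite /upper_bidiagonal (gtn_eqF ik) gtn_eqF ?addr0 // ltnW.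
- by apply: totally_positive_upper_bidiagonal => // i; apply: rpred1.
apply: totally_positive_tr.
by apply: totally_positive_upper_bidiagonal => // i; apply: rpred1.
Qed.

Definition head_const (u v : K) (k : nat) : K := if k is 0 then u else v.

Lemma totally_positive_jacobi_head_const a e x :
  a \in S -> e \in S -> x \in S ->
  totally_positive S
    (jacobi (head_const (a + e * x) (1 + x)) (head_const ((a + e) * x) x)).
Proof.
move=> aS eS xS; apply: totally_positive_tr.
pose factored d l := jacobi (fun k => d k + l k) (fun k => d k.+1 * l k).
pose A := factored (head_const 0 x) (fun=> 1).
pose E := factored (head_const 0 1) (fun=> x).
apply: (totally_positive_row0_lincomb (A := fun i j => A j i)
  (B := fun i j => E j i) aS eS) => [||j|i j|i j].
- by apply/totally_positive_tr/totally_positive_jacobi => [[|k]|k];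
    rewrite /= ?rpred0 ?rpred1.
- by apply/totally_positive_tr/totally_positive_jacobi => [[|k]|k];
    rewrite /= ?rpred0 ?rpred1.
- by rewrite /A /E /factored /jacobi /=; ring.
- by rewrite /A /factored /jacobi /=; ring.
- by rewrite /E /factored /jacobi /=; ring.
Qed.

End Jacobi.

Section CatalanStieltjes.
Variables (K : comPzRingType) (S : semiringClosed K).
Variables (s t : nat -> K) (c : nat -> nat -> K).

Definition catalan_stieltjes : Prop :=
  [/\ c 0%N 0%N = 1, forall n k, (n < k)%N -> c n k = 0 &
      forall n k, c n.+1 k =
        (if k is k'.+1 then c n k' else 0) + s k * c n k + t k * c n k.+1].

Hypothesis c_stieltjes : catalan_stieltjes.

Let c00 : c 0%N 0%N = 1. Proof. by case: c_stieltjes. Qed.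

Let c_eq0 n k : (n < k)%N -> c n k = 0.
Proof. by case: c_stieltjes => _ + _; apply. Qed.

Let c_rec n k : c n.+1 k =
  (if k is k'.+1 then c n k' else 0) + s k * c n k + t k * c n k.+1.
Proof. by case: c_stieltjes. Qed.

Lemma catalan_stieltjes_mul_jacobi n k :
  c n.+1 k = \sum_(j < n.+1) c n j * jacobi s t j k.
Proof.
have pick p l : \sum_(j < n.+1) c n j * (p *+ (j == l :> nat)) = p * c n l.
  under eq_bigr do rewrite mulrnAr mulrb.
  rewrite -big_mkcond (big_ord1_eq _ (fun j => c n j * p)) mulrC.
  by case: ltnP => // /c_eq0->; rewrite mulr0.
rewrite c_rec; under eq_bigr do rewrite !mulrDr.
rewrite !big_split /= !pick; congr (_ + _ + _).
case: k => [|k]; first by rewrite big1 // => j _; rewrite mulr0.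
by rewrite -[c n k]mul1r -pick; apply: eq_bigr => j _; rewrite eqSS eq_sym.
Qed.

Lemma totally_positive_catalan_stieltjes :
  totally_positive S (jacobi s t) -> totally_positive S c.
Proof.
(* Rows [1, 2, ...] of the first [n + 1] rows of [c] are the first [n] rows of
   [c] multiplied by [jacobi s t]. *)
move=> J_tp; pose first_rows n i j := c i j *+ (i < n).
have first_rows_tp n : totally_positive S (first_rows n).
  elim: n => [|n IHn].
    by apply: totally_positive_upper_band => i j; rewrite /first_rows ?rpred0.
  apply: totally_positive_of_behead_rows => [|j|]; rewrite /first_rows.
  - by rewrite c00 rpred1.
  - by rewrite c_eq0.
  apply: (totally_positive_mul (b := succn) (A := first_rows n)
    (B := jacobi s t)) => //.
    by move=> i k ik; rewrite /first_rows c_eq0 ?mul0rn.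
  move=> i j; rewrite ltnS catalan_stieltjes_mul_jacobi -sumrMnl.
  by apply: eq_bigr => k _; rewrite mulrnAl.
move=> m r k ri ki.
rewrite (@eq_minor _ _ (first_rows (\max_i r i).+1)) => [|i j].
  exact: first_rows_tp.
by rewrite /first_rows ltnS leq_bigmax.
Qed.

Definition hankel_weight (k : nat) : K := \prod_(i < k) t i.

Local Notation w := hankel_weight.

(* Summation by parts: [w] symmetrizes [jacobi s t], so only the boundary term
   remains. *)
Lemma sum_shift_hankel_weight N i j :
  \sum_(k < N.+1) w k * (c i.+1 k * c j k - c i k * c j.+1 k) =
  w N.+1 * (c i N.+1 * c j N - c i N * c j N.+1).
Proof.
elim: N => [|N IHN]; rewrite big_ord_recr /=.
  by rewrite big_ord0 /w big_ord_recr big_ord0 !c_rec /=; ring.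
by rewrite IHN !c_rec /w [in RHS]big_ord_recr /=; ring.
Qed.

Lemma hankel_catalan_stieltjes i j :
  c (i + j)%N 0%N = \sum_(k < i.+1) c i k * (w k * c j k).
Proof.
elim: i j => [|i IHi] j.
  by rewrite big_ord1 c00 /w big_ord0 !mul1r.
transitivity (\sum_(k < i.+2) c i k * (w k * c j.+1 k)).
  by rewrite addSnnS IHi [RHS]big_ord_recr /= c_eq0 ?mul0r ?addr0.
apply/esym/eqP; rewrite -subr_eq0 -sumrB; apply/eqP.
transitivity (\sum_(k < i.+2) w k * (c i.+1 k * c j k - c i k * c j.+1 k)).
  by apply: eq_bigr => k _; ring.
by rewrite sum_shift_hankel_weight !(c_eq0 (n := i)) // !mul0r subrr mulr0.
Qed.

Theorem totally_positive_hankel_catalan_stieltjes :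
  (forall k, t k \in S) -> totally_positive S (jacobi s t) ->
  totally_positive S (fun i j => c (i + j)%N 0%N).
Proof.
move=> tS /totally_positive_catalan_stieltjes c_tp.
apply: (totally_positive_mul (b := succn) (A := c) (B := fun k j => w k * c j k)
  c_eq0 hankel_catalan_stieltjes c_tp).
apply: totally_positive_scale_rows => [k|]; first exact: rpred_prod.
exact: totally_positive_tr.
Qed.

End CatalanStieltjes.

Theorem totally_positive_hankel_head_const (K : comPzRingType)
    (S : semiringClosed K) (a e x : K) (c : nat -> nat -> K) :
  a \in S -> e \in S -> x \in S ->
  catalan_stieltjes (head_const (a + e * x) (1 + x))
    (head_const ((a + e) * x) x) c ->
  totally_positive S (fun i j => c (i + j)%N 0%N).
Proof.
move=> aS eS xS c_stieltjes.
apply: (totally_positive_hankel_catalan_stieltjes c_stieltjes).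
  by case=> [|k]; rewrite ?rpredM ?rpredD.
exact: totally_positive_jacobi_head_const.
Qed.

Section NonnegativePolynomials.
Variable R : realType.
Implicit Types (a e f : R) (c : nat -> nat -> {poly R}).

Definition nneg_poly : semiringClosed {poly R} :=
  GRing.SemiringClosed.clone _ (polyOver_pred (@Num.Def.nneg_num_pred R)) _.

Lemma nneg_polyE (p : {poly R}) :
  (p \in nneg_poly) = (p \is a polyOver Num.nneg).
Proof. by []. Qed.

Lemma nneg_polyC a : (a%:P \in nneg_poly) = (0 <= a).
Proof. by rewrite nneg_polyE polyOverC nnegrE. Qed.

Lemma nneg_polyX : 'X \in nneg_poly.
Proof. by rewrite nneg_polyE polyOverX. Qed.

Lemma q_totally_positiveW (M : nat -> nat -> {poly R}) :
  totally_positive nneg_poly M -> q_totally_positive M.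
Proof.
move=> M_tp m r c ri ci d; have := M_tp m r c ri ci.
by rewrite nneg_polyE => /polyOverP/(_ d).
Qed.

Lemma recurrence1_catalan_stieltjes e f c :
  c 0%N 0%N = 1 -> (forall n k, (n < k)%N -> c n k = 0) -> recurrence1 e f c ->
  catalan_stieltjes (head_const ((f - e)%:P + e%:P * 'X) (1 + 'X))
    (head_const (((f - e)%:P + e%:P) * 'X) 'X) c.
Proof.
move=> c00 c_eq0 [rec0 recS]; split=> // n [|k]; last exact: recS.
by rewrite rec0 /= add0r -!mul_polyC -polyCD subrK.
Qed.

Lemma recurrence2_catalan_stieltjes e f c :
  c 0%N 0%N = 1 -> (forall n k, (n < k)%N -> c n k = 0) -> recurrence2 e f c ->
  catalan_stieltjes (head_const ((f - 1)%:P + 1 * (e *: 'X)) (1 + e *: 'X))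
    (head_const (((f - 1)%:P + 1) * (e *: 'X)) (e *: 'X)) c.
Proof.
move=> c00 c_eq0 [rec0 recS]; split=> // n [|k]; last exact: recS.
by rewrite rec0 /= -!mul_polyC polyCM polyCB; ring.
Qed.

End NonnegativePolynomials.

Theorem theorem4p3 (R : realType) (c : nat -> nat -> {poly R})
    (c00 : c 0%N 0%N = 1)
    (c_eq0 : forall n k : nat, (n < k)%N -> c n k = 0)
    (c_rec :
       (exists e f : R, 0 <= e /\ e <= f /\ recurrence1 e f c) \/
       (exists e f : R, 1 <= e /\ 1 <= f /\ recurrence2 e f c)) :
  q_totally_positive (fun i j : nat => c (i + j)%N 0%N).
Proof.
apply: q_totally_positiveW.
case: c_rec => -[e [f [e_ge [f_ge rec]]]].
- have := recurrence1_catalan_stieltjes c00 c_eq0 rec.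
  by apply: totally_positive_hankel_head_const;
    rewrite ?nneg_polyX ?nneg_polyC ?subr_ge0.
- have := recurrence2_catalan_stieltjes c00 c_eq0 rec.
  apply: totally_positive_hankel_head_const.
  + by rewrite nneg_polyC subr_ge0.
  + exact: rpred1.
  + by rewrite -mul_polyC rpredM ?nneg_polyX // nneg_polyC (le_trans ler01).
Qed.
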